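(* Let $n\ge 2$, $q\in(0,1]$, $s\ge 0$, and consider the Waxman random graph with parameters $(n,q,s)$ on a region $R$, with inter-point distance density $g$ and Laplace transform $\tilde G(s)=\int_0^\infty e^{-st}g(t)\,dt$. Then: (a) for $i\ne j$, the probability (prior to knowing the distances) that $(i,j)$ is an edge is $q\,\tilde G(s)$; (b) the expected degree of a node is $\bar k=(n-1)\,q\,\tilde G(s)$; (c) the expected number of edges is $\bar e=\dfrac{n(n-1)\,q\,\tilde G(s)}{2}$; (d) conditionally on $(i,j)$ being an edge, the length $d_{ij}$ has probability density $$f(d\mid s)=\frac{g(d)\,e^{-sd}}{\tilde G(s)},$$ which does not depend on $q$; (e) the mean length of an edge is $$\mathbb{E}[d\mid s]=\frac{1}{\tilde G(s)}\int_0^\infty t\,g(t)\,e^{-st}\,dt=-\frac{\tilde G'(s)}{\tilde G(s)}.$$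
   Context: Waxman random graph: $n$ nodes are placed independently and uniformly at random in a region $R$ of a metric space with metric $d(\cdot,\cdot)$ (carrying a notion of uniform distribution on $R$). Let $d_{ij}$ be the distance between nodes $i$ and $j$. Given the positions, each unordered pair of distinct nodes $\{i,j\}$ is made an edge, independently of other pairs, with probability $p(d_{ij})=q\,e^{-s d_{ij}}$. The function $g$ on $[0,\infty)$ is the probability density of the distance between two independent uniformly random points of $R$ (assumed to exist, with finite mean). At $s=0$, $\tilde G'(0)$ is the right derivative. The mean edge length $\mathbb{E}[d\mid s]$ means the expectation of $d_{ij}$ conditional on $(i,j)$ being an edge. *)

(* Defs.v *)
From HB Require Import structures.
From mathcomp Require Import all_boot all_order all_algebra.
From mathcomp Require Import all_classical all_reals all_analysis.

Set Implicit Arguments.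
Unset Strict Implicit.
Unset Printing Implicit Defensive.
Import Order.TTheory GRing.Theory Num.Theory.
Import numFieldNormedType.Exports.
Local Open Scope classical_set_scope.
Local Open Scope ring_scope.

(* A metric space that also carries a sigma-algebra.  The two structures are
   unrelated here: the theorem assumes that the distance is jointly measurable,
   which holds for the Borel sigma-algebra of a separable metric space. *)
#[short(type="measurableMetricType")]
HB.structure Definition MeasurableMetric (d : measure_display)
  (K : numDomainType) := {M of Measurable d M & Metric K M}.

(* [U] is the uniform distribution on the region [D], uniformity being relative
   to a reference measure [nu] on the space (area, volume, Hausdorff measure). *)
Definition uniform_on d (M : measurableType d) (R : realType)
    (nu : {measure set M -> \bar R}) (D : set M) (U : probability M R) : Prop :=
  [/\ measurable D, (0 < nu D < +oo)%E &
      forall A, measurable A -> U A = (nu (A `&` D) / nu D)%E].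

(* [f] is only relevant on [0, +oo[; the law is then concentrated there. *)
Definition has_density (R : realType) (law : set R -> \bar R) (f : R -> R)
    : Prop :=
  [/\ measurable_fun `[0 : R, +oo[ f,
      (forall t, 0 <= t -> 0 <= f t) &
      forall A, measurable A -> law A =
        (\int[lebesgue_measure]_(t in A `&` `[0%R : R, +oo[%classic) (f t)%:E)%E].

Definition distance_law d (R : realType) (M : measurableMetricType d R)
    (U : probability M R) : set R -> \bar R :=
  fun A => (U \x U)%E [set xy : M * M | A (mdist xy.1 xy.2)].

Definition laplace (R : realType) (g : R -> R) (s : R) : R :=
  \int[lebesgue_measure]_(t in `[0, +oo[) (expR (- s * t) * g t).

Definition is_laplace_deriv (R : realType) (g : R -> R) (s D : R) : Prop :=
  if s == 0 then
    h^-1 * (laplace g h - laplace g 0) @[h --> 0^'+] --> D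
  else is_derive s 1 (laplace g) D.

Definition waxman_prob (R : realType) (q s x : R) : R := q * expR (- s * x).

(* [Y] is a version of the conditional probability of [A] given the
   sigma-algebra [G]. *)
Definition is_cond_prob d (T : measurableType d) (R : realType)
    (P : probability T R) (G : set_system T) (A : set T) (Y : T -> R) : Prop :=
  (forall B : set R, measurable B -> G (Y @^-1` B)) /\
  (forall C, G C -> (\int[P]_(w in C) (Y w)%:E)%E = P (A `&` C)).

(* Unordered pairs of distinct nodes are encoded as ordered pairs (i, j) with
   i < j.  The last field is both the edge probabilities (for F a single pair)
   and the independence of the edges given the positions (product rule over
   every finite set F of pairs). *)
Record waxman_graph d d' (T : measurableType d) (R : realType)
    (M : measurableMetricType d' R) (P : probability T R) (U : probability M R)
    (n : nat) (q s : R) := WaxmanGraph {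
  pos : 'I_n -> {RV P >-> M};
  adj : T -> rel 'I_n;
  adj_sym : forall w, symmetric (adj w);
  adj_irr : forall w, irreflexive (adj w);
  adj_measurable : forall i j, measurable [set w | adj w i j];
  pos_law : forall i A, measurable A -> distribution P (pos i) A = U A;
  pos_indep : forall A : 'I_n -> set M, (forall i, measurable (A i)) ->
    P (\bigcap_i (pos i @^-1` A i)) =
    (\prod_(i < n) P (pos i @^-1` A i))%E;
  adj_cond : forall F : {set 'I_n * 'I_n},
    (forall ij, ij \in F -> (ij.1 < ij.2)%N) ->
    is_cond_prob P (g_sigma_preimage pos)
      (\bigcap_(ij in [set` F]) [set w | adj w ij.1 ij.2])
      (fun w => \prod_(ij in F)
         waxman_prob q s (mdist (pos ij.1 w) (pos ij.2 w)))
}.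

Section waxman.
Context d d' (T : measurableType d) (R : realType)
  (M : measurableMetricType d' R) (P : probability T R) (U : probability M R)
  (n : nat) (q s : R) (W : waxman_graph P U n q s).

Definition edge (i j : 'I_n) : set T := [set w | adj W w i j].

Definition len (i j : 'I_n) (w : T) : R := mdist (pos W i w) (pos W j w).

Definition degree (i : 'I_n) (w : T) : nat := #|[pred j | adj W w i j]|.

Definition num_edges (w : T) : nat :=
  #|[pred ij : 'I_n * 'I_n | (ij.1 < ij.2)%N && adj W w ij.1 ij.2]|.

(* P( . | (i, j) is an edge); [mnormalize] would fall back to P if the edge had
   probability 0. *)
Definition edge_cond (i j : 'I_n) : probability T R :=
  mnormalize (mrestr P (adj_measurable W i j)) P.

End waxman.

Definition edge_length_density (R : realType) (g : R -> R) (s x : R) : R :=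
  g x * expR (- s * x) / laplace g s.

(* Main.v *)
Require Import Defs.
From HB Require Import structures.
From mathcomp Require Import all_boot all_order all_algebra.
From mathcomp Require Import all_classical all_reals all_analysis.
From mathcomp Require Import measurable_realfun ring lra.
Import Order.TTheory GRing.Theory Num.Theory.
Import numFieldNormedType.Exports.
Local Open Scope classical_set_scope.
Local Open Scope ring_scope.

(** The positions of two distinct nodes are independent and uniform, so their
distance has the law with density [g].  Conditioning on all positions turns
the edge indicator into [q * exp (- s * len)], and integrating this over the
event that the length lies in [A] gives the key identity [prob_edge_len]:

  P (i ~ j and len in A) = int_(A, t >= 0) q exp (- s t) g t dt.

Everything else is read off from it.  With [A] the whole line it is the edge
probability [q * laplace g s]; summing indicators over the pairs gives the
expected degree and the expected number of edges.  Dividing by the edge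
probability gives the conditional law of the length, and [q] cancels; its
density is proportional to [exp (- s t) g t].  Its mean is therefore the
first moment of that function over [laplace g s], and the moment is minus the
derivative of the Laplace transform by dominated convergence: for [s] and
[s + h] nonnegative, the difference quotients of [exp (- s t) g t] in [s] are
bounded by [t * g t], which has a finite integral because [g] has a finite
mean ([laplace_slope_cvg]).  The same bound serves for the one-sided
derivative at 0 and for the two-sided derivative elsewhere. *)

Set Implicit Arguments.
Unset Strict Implicit.
Unset Printing Implicit Defensive.

(** * Integration against a law with a density *)

Section density.
Context d (T : measurableType d) (R : realType) (P : probability T R).
Local Notation leb := (@lebesgue_measure R).
Local Notation Rplus := (`[0%R : R, +oo[%classic).

(** [f], extended by 0 to the negative half-line, is a Radon-Nikodym derivative
of the law of [X]: any other one has the same integrals over measurable sets,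
so the two agree almost everywhere and the change of variables formula for
such derivatives applies to [f]. *)
Lemma integral_has_density (X : T -> R) (f : R -> R) (h : R -> \bar R)
    (A : set R) :
  measurable_fun setT X -> has_density (fun B => P (X @^-1` B)) f ->
  measurable_fun setT h -> (forall x, 0 <= h x)%E -> measurable A ->
  (\int[P]_(w in X @^-1` A) h (X w) =
   \int[leb]_(x in A `&` Rplus) (h x * (f x)%:E))%E.
Proof.
move=> mX [mf f0 Xf] mh h0 mA.
have mR : measurable Rplus by exact: measurable_itv.
pose fR := (EFin \o f) \_ Rplus.
have mfR : measurable_fun setT fR.
  by apply/(measurable_restrictT _ mR); exact/measurable_EFinP.
have fR0 x : (0 <= fR x)%E.
  by apply: erestrict_ge0 => y /=; rewrite in_itv/= andbT lee_fin; exact: f0.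
(* Lebesgue measure lives on this copy of the reals; the law of X is put on the
   same copy so that the two measures can be compared. *)
have mX' : measurable_fun setT (X : T -> measurableTypeR R) by exact: mX.
pose X' : {mfun T >-> measurableTypeR R} :=
  HB.pack (X : T -> measurableTypeR R) (isMeasurableFun.Build _ _ _ _ _ mX').
pose law : {finite_measure set (measurableTypeR R) -> \bar R} :=
  distribution P X'.
have lawE B : measurable B ->
    law B = (\int[leb]_(x in B) fR x)%E.
  by move=> mB; rewrite -integral_mkcondr -Xf.
have dom : law `<< leb.
  apply/null_content_dominatesP => B mB B0.
  by rewrite lawE//; apply: null_set_integral => //; exact: measurable_funTS.
transitivity (\int[law]_(x in A) h x)%E.
  rewrite ge0_integral_pushforward//; first exact: measurable_funTS.
rewrite -(Radon_Nikodym_SigmaFinite.change_of_variables dom)//; last first.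
  exact: measurable_funTS.
have rint := Radon_Nikodym_SigmaFinite.f_integrable dom.
rewrite (_ : (fun x => h x * (f x)%:E)%E = (h \* (EFin \o f))%E)//.
rewrite integral_mkcondr.
have -> : ((h \* (EFin \o f)) \_ Rplus)%E = (h \* fR)%E.
  by apply/funext => x; rewrite /fR !patchE; case: ifPn => // _; rewrite mule0.
apply: ae_eq_integral => //.
- apply: emeasurable_funM; first exact: measurable_funTS.
  by apply: measurable_funTS; exact: measurable_int rint.
- by apply: emeasurable_funM; exact: measurable_funTS.
- apply: ae_eqe_mul2l; apply: integral_ae_eq => //.
  + exact: integrableS rint.
  + exact: measurable_funTS.
  + by move=> B _ mB; rewrite -Radon_Nikodym_SigmaFinite.f_integral// lawE.
Qed.
End density.

(** * Positions and edges *)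

Lemma measurable_waxman_prob (R : realType) (D : set R) (q s : R) :
  measurable_fun D (waxman_prob q s).
Proof.
rewrite /waxman_prob; apply: measurable_funM => //.
by apply: measurableT_comp => //; exact: measurable_funM.
Qed.

Section positions.
Context d d' (T : measurableType d) (R : realType)
  (M : measurableMetricType d' R) (P : probability T R) (U : probability M R)
  (n : nat) (q s : R) (W : waxman_graph P U n q s).
Hypothesis mdist_meas : measurable_fun setT (fun xy : M * M => mdist xy.1 xy.2).

Lemma measurable_len (i j : 'I_n) : measurable_fun setT (len W i j).
Proof.
have mp : measurable_fun setT (fun w => (pos W i w, pos W j w)).
  by apply: measurable_fun_pair; exact: measurable_funP.
exact: measurableT_comp mdist_meas mp.
Qed.

(** The defining property of a conditional probability can only be used on
events determined by the positions, and this is one.  At [s = 0] the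
conditional edge probability is constant and does not determine the length,
so the event is placed directly in the generated sigma-algebra. *)
Lemma sigma_positions_len (i j : 'I_n) (A : set R) :
  measurable A -> g_sigma_preimage (pos W) (len W i j @^-1` A).
Proof.
move=> mA.
pose GT := g_sigma_algebraType (\big[setU/set0]_(k < n)
  preimage_set_system setT (pos W k) (@measurable _ M)).
have mpos k : measurable_fun setT (pos W k : GT -> M).
  move=> _ B mB; apply: sub_sigma_algebra.
  by rewrite (bigD1 k)//=; left; exists B.
have mp : measurable_fun setT ((fun w => (pos W i w, pos W j w)) : GT -> M * M).
  exact: measurable_fun_pair (mpos i) (mpos j).
have mlen : measurable_fun setT (len W i j : GT -> R).
  exact: measurableT_comp mdist_meas mp.
by have := mlen measurableT _ mA; rewrite setTI.
Qed.

(** Independence gives the product formula on rectangles, which characterizes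
the product measure. *)
Lemma pair_law (i j : 'I_n) (B : set (M * M)) : i != j -> measurable B ->
  P ((fun w => (pos W i w, pos W j w)) @^-1` B) = (U \x U)%E B.
Proof.
move=> ij mB.
have mp : measurable_fun setT (fun w => (pos W i w, pos W j w)).
  by apply: measurable_fun_pair; exact: measurable_funP.
pose X : {mfun T >-> (M * M)%type} := HB.pack (fun w => (pos W i w, pos W j w))
  (isMeasurableFun.Build _ _ _ _ _ mp).
symmetry; apply: (@product_measure_unique _ _ _ _ _ U U (distribution P X)) => //.
move=> A1 A2 mA1 mA2 /=.
(* Constrain nodes i and j only: the other factors have probability 1. *)
pose A k := if k == i then A1 else if k == j then A2 else setT.
have mA k : measurable (A k) by rewrite /A; case: ifP => // _; case: ifP.
have := pos_indep W mA.
have PA k : P (pos W k @^-1` A k) = U (A k) by rewrite -(pos_law W k) //.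
under [in RHS]eq_bigr do rewrite PA.
rewrite (bigD1 i)//= (bigD1 j) 1?eq_sym//= big1 ?mule1; last first.
  by move=> k /andP[/negPf ki /negPf kj]; rewrite /A ki kj probability_setT.
rewrite /A !eqxx eq_sym (negPf ij) => <-.
congr (P _); apply/seteqP; split=> w /=.
  move=> [w1 w2] k _ /=; case: eqP => [->//|_]; case: eqP => [->//|//].
move=> H; split; first by have := H i I; rewrite /= eqxx.
by have := H j I; rewrite /= eqxx eq_sym (negPf ij).
Qed.

Lemma len_law (i j : 'I_n) (A : set R) : i != j -> measurable A ->
  P (len W i j @^-1` A) = distance_law U A.
Proof.
move=> ij mA; rewrite /distance_law -(pair_law ij)//.
by have := @mdist_meas measurableT _ mA; rewrite setTI.
Qed.

Lemma edge_sym (i j : 'I_n) : edge W i j = edge W j i.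
Proof. by apply/seteqP; split=> w; rewrite /edge/= adj_sym. Qed.

Lemma len_sym (i j : 'I_n) : len W i j = len W j i.
Proof. by apply/funext => w; rewrite /len metric_sym. Qed.

(** This is the conditional edge probability for the single pair [{i, j}],
integrated over a position event; the order [i < j] is immaterial by
symmetry of the edges and of the distance. *)
Lemma prob_edge_len_cond (i j : 'I_n) (A : set R) : i != j -> measurable A ->
  P (edge W i j `&` len W i j @^-1` A) =
  (\int[P]_(w in len W i j @^-1` A) (waxman_prob q s (len W i j w))%:E)%E.
Proof.
move=> ij mA; wlog lt_ij : i j ij / (i < j)%N.
  move=> H; have [/H->//|ji|/val_inj eij] := ltngtP i j.
    by rewrite edge_sym len_sym; apply: H => //; rewrite eq_sym.
  by rewrite eij eqxx in ij.
have F1 kl : kl \in [set (i, j)]%SET -> (kl.1 < kl.2)%N by move=> /set1P ->.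
have [_ /(_ _ (sigma_positions_len i j mA))] := adj_cond W F1.
under eq_integral do rewrite big_set1 /=.
move=> ->; congr (P (_ `&` _)).
apply/seteqP; split=> [w ew kl /=|w /(_ (i, j))]; last by apply; exact/set1P.
by move=> /set1P ->.
Qed.

(** The joint law of edge and length, from which the edge probability and the
conditional law of the length both follow. *)
Lemma prob_edge_len (g : R -> R) (i j : 'I_n) (A : set R) :
  0 < q -> has_density (distance_law U) g -> i != j -> measurable A ->
  P (edge W i j `&` len W i j @^-1` A) =
  (\int[lebesgue_measure]_(x in A `&` `[0%R, +oo[)
     (waxman_prob q s x * g x)%:E)%E.
Proof.
move=> q0 [mg g0 Ug] ij mA; rewrite prob_edge_len_cond//.
rewrite (@integral_has_density _ _ _ P (len W i j) g
   (fun x => (waxman_prob q s x)%:E))//.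
- exact: measurable_len.
- by split=> // B mB; rewrite len_law// Ug.
- by apply/measurable_EFinP; exact: measurable_waxman_prob.
- by move=> x; rewrite lee_fin mulr_ge0 ?expR_ge0// ltW.
Qed.
End positions.

(** * The Laplace transform and its derivative *)

Section laplace.
Context (R : realType).
Local Notation leb := (@lebesgue_measure R).
Local Notation Rplus := (`[0%R : R, +oo[%classic).
Implicit Types s t x : R.

(** The source of the dominating function [t * g t].  It uses that both
exponents are nonpositive, which is why the endpoint [s = 0] only allows a
one-sided derivative. *)
Lemma expR_lipschitz x s t : 0 <= x -> 0 <= s -> 0 <= t ->
  `|expR (- x * t) - expR (- s * t)| <= `|x - s| * t.
Proof.
move=> x0 s0 t0; wlog xs : x s x0 s0 / x <= s.
  move=> H; have [/H->//|/ltW sx] := leP x s.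
  by rewrite distrC (distrC x); exact: H.
(* For x <= s, factor out exp (- x t) <= 1 and use 1 - exp (- y) <= y. *)
have E0 : expR (- x * t) - expR (- s * t) =
    expR (- x * t) * (1 - expR (- ((s - x) * t))).
  by rewrite mulrBr mulr1 -expRD; congr (_ - expR _); ring.
have E1 : expR (- x * t) <= 1 by rewrite -expR0 ler_expR mulNr oppr_le0 mulr_ge0.
have E2 : expR (- ((s - x) * t)) <= 1.
  by rewrite -expR0 ler_expR oppr_le0 mulr_ge0// subr_ge0.
have E3 := expR_ge1Dx (- ((s - x) * t)).
rewrite E0 ger0_norm; last by rewrite mulr_ge0 ?expR_ge0 ?subr_ge0.
rewrite ler0_norm ?subr_le0// opprB.
apply: (@le_trans _ _ (1 * (1 - expR (- ((s - x) * t))))).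
  by rewrite ler_wpM2r ?subr_ge0.
by rewrite mul1r; lra.
Qed.

Lemma expR_slope_cvg s t (u : R^nat) :
  (forall n, u n != 0) -> u n @[n --> \oo] --> 0 ->
  (u n)^-1 * (expR (- (s + u n) * t) - expR (- s * t)) @[n --> \oo]
    --> - t * expR (- s * t).
Proof.
move=> u0 ucvg.
have dE : is_derive s 1 (fun x => expR (- x * t)) (- t * expR (- s * t)).
  have dl : is_derive s (1 : R) (fun x => - x * t) (- t).
    rewrite (_ : (fun x => - x * t) = (fun x => x * - t)); last first.
      by apply/funext => x; rewrite mulrN mulNr.
    by apply: is_derive_eq; rewrite /= scaler0 add0r /GRing.scale/= mulr1.
  by apply: is_derive_eq (is_derive1_comp _ _) _; rewrite mulrC.
have [/cvg_ex[/= l dl] <-] := dE.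
rewrite /derive (cvg_lim _ dl)//.
move/cvgr_dnbhsP : dl => /(_ u (conj u0 ucvg)).
apply: cvg_trans; apply: near_eq_cvg; apply: nearW => n.
by rewrite /= {1}/GRing.scale/= scaler1 (addrC s).
Qed.

Let mR : measurable Rplus. Proof. exact: measurable_itv. Qed.

Lemma integrable_damped (f : R -> R) s : 0 <= s ->
  leb.-integrable Rplus (EFin \o f) ->
  leb.-integrable Rplus (EFin \o (fun t => expR (- s * t) * f t)).
Proof.
move=> s0 fi; have mf : measurable_fun Rplus f.
  by apply/measurable_EFinP; exact: measurable_int fi.
apply: le_integrable fi => //.
  apply/measurable_EFinP; apply: measurable_funM => //.
  by apply: measurableT_comp => //; exact: measurable_funM.
move=> t; rewrite /= in_itv/= andbT => t0; rewrite lee_fin normrM.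
rewrite ger0_norm ?expR_ge0// ler_piMl// -expR0 ler_expR mulNr oppr_le0.
exact: mulr_ge0.
Qed.

Section laplace_transform.
Variable g : R -> R.
Hypothesis g_ge0 : forall t, 0 <= t -> 0 <= g t.
Hypothesis g_int : leb.-integrable Rplus (EFin \o g).

Lemma EFin_laplace s : 0 <= s ->
  (laplace g s)%:E = (\int[leb]_(t in Rplus) (expR (- s * t) * g t)%:E)%E.
Proof.
move=> s0; rewrite fineK//; apply: integrable_fin_num => //.
exact: integrable_damped.
Qed.

(** If the transform vanished then so would [exp (- s t) g t] almost everywhere,
hence also [g], since the exponential is never 0. *)
Lemma laplace_gt0 s : 0 <= s ->
  (\int[leb]_(t in Rplus) (g t)%:E != 0)%E -> 0 < laplace g s.
Proof.
move=> s0 g_neq0; have damped_ge0 t : Rplus t -> 0 <= expR (- s * t) * g t.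
  by rewrite /= in_itv/= andbT => t0; rewrite mulr_ge0 ?expR_ge0 ?g_ge0.
rewrite lt_def; apply/andP; split; last by apply: Rintegral_ge0.
apply: contra g_neq0 => /eqP L0.
have mdamped := measurable_int _ (integrable_damped s0 g_int).
have : (\int[leb]_(t in Rplus) `|(expR (- s * t) * g t)%:E| = 0)%E.
  transitivity (laplace g s)%:E; last by rewrite L0.
  rewrite EFin_laplace//; apply: eq_integral => t /[!inE] tR.
  by rewrite gee0_abs// lee_fin damped_ge0.
move/(ae_eq_integral_abs leb mR mdamped) => ae0; apply/eqP.
rewrite -[RHS](integral0 leb Rplus); apply: ae_eq_integral => //.
  exact: measurable_int g_int.
apply: filterS ae0 => t /[apply] /= -[] /eqP.
by rewrite mulf_eq0 gt_eqF ?expR_gt0//= => /eqP ->.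
Qed.

Hypothesis tg_int : leb.-integrable Rplus (EFin \o (fun t => t * g t)).

(** Dominated convergence for the difference quotients.  Stating it along
sequences of increments keeping [s + u n] nonnegative serves the
right derivative at 0 and the ordinary derivative at [s > 0] alike. *)
Lemma laplace_slope_cvg s (u : R^nat) : 0 <= s ->
  (forall n, 0 <= s + u n) -> (forall n, u n != 0) ->
  u n @[n --> \oo] --> 0 ->
  (u n)^-1 * (laplace g (s + u n) - laplace g s) @[n --> \oo] -->
  - (\int[leb]_(t in Rplus) (t * g t * expR (- s * t))).
Proof.
move=> s0 su0 u0 ucvg.
pose slope n t := (u n)^-1 * (expR (- (s + u n) * t) - expR (- s * t)) * g t.
pose limit t := - (t * g t * expR (- s * t)).
have slopeE n : (u n)^-1 * (laplace g (s + u n) - laplace g s) =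
    \int[leb]_(t in Rplus) slope n t.
  rewrite /laplace -RintegralB//; [|exact: integrable_damped..].
  rewrite -RintegralZl//; last first.
    rewrite (_ : _ \o _ = (EFin \o (fun t => expR (- (s + u n) * t) * g t)%R) \-
                          (EFin \o (fun t => expR (- s * t) * g t)%R))%E//.
    by apply: integrableB => //; exact: integrable_damped.
  by apply: eq_Rintegral => t _; rewrite /slope; ring.
have limit_int : leb.-integrable Rplus (EFin \o limit).
  rewrite (_ : _ \o _ = -%E \o (EFin \o (fun t => expR (- s * t) * (t * g t)))).
    by apply: integrableN => //; exact: integrable_damped.
  by apply/funext => t /=; rewrite /limit mulrC.
have limitE : - (\int[leb]_(t in Rplus) (t * g t * expR (- s * t))) =
    \int[leb]_(t in Rplus) limit t.
  under eq_Rintegral do rewrite mulrC.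
  rewrite -mulN1r -RintegralZl//; last exact: integrable_damped.
  by apply: eq_Rintegral => t _; rewrite mulN1r /limit mulrC.
rewrite limitE (eq_cvg _ _ slopeE).
have mslope n : measurable_fun Rplus (EFin \o slope n).
  apply/measurable_EFinP; apply: measurable_funM.
    apply: measurable_funM => //; apply: measurable_funB;
      by apply: measurableT_comp => //; exact: measurable_funM.
  by apply/measurable_EFinP; exact: measurable_int g_int.
have slope_cvg : {ae leb, forall t, Rplus t ->
    (EFin \o slope n) t @[n --> \oo] --> (EFin \o limit) t}.
  apply: aeW => t tR; apply: cvg_EFin; first exact: nearW.
  rewrite /limit /slope /comp/=.
  have -> : - (t * g t * expR (- s * t)) = - t * expR (- s * t) * g t by ring.
  by apply: cvgMl; exact: expR_slope_cvg.
have slope_dom : {ae leb, forall t n, Rplus t ->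
    (`|(EFin \o slope n) t| <= (EFin \o (fun t => t * g t)%R) t)%E}.
  apply: aeW => t n; rewrite /= in_itv/= andbT => t0.
  rewrite lee_fin /slope normrM (ger0_norm (g_ge0 t0)) ler_wpM2r ?g_ge0//.
  rewrite normrM normfV ler_pdivrMl ?normr_gt0//.
  by rewrite (le_trans (expR_lipschitz _ _ _))// addrC addKr.
have [_ _] := @dominated_convergence _ _ _ leb _ mR _ _ _ mslope
  (measurable_int _ limit_int) slope_cvg tg_int slope_dom.
by move=> int_cvg; apply: fine_cvg; rewrite fineK//; exact: integrable_fin_num.
Qed.

Lemma is_laplace_deriv_moment s : 0 <= s ->
  is_laplace_deriv g s
    (- \int[leb]_(t in Rplus) (t * g t * expR (- s * t))).
Proof.
move=> s0; rewrite /is_laplace_deriv; case: eqP => [->|/eqP s_neq0].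
  apply/cvg_at_rightP => u [u0 ucvg].
  apply: cvg_trans (@laplace_slope_cvg 0 u _ _ _ ucvg) => //.
  - by apply: near_eq_cvg; apply: nearW => n; rewrite /= add0r.
  - by move=> n; rewrite add0r ltW.
  - by move=> n; rewrite gt_eqF.
have s_gt0 : 0 < s by rewrite lt_def s_neq0.
set D := - _; suff dl :
    h^-1 *: (laplace g (h *: 1 + s) - laplace g s) @[h --> 0^'] --> D.
  by apply: DeriveDef; [apply/cvg_ex; exists D | exact: cvg_lim dl].
apply/cvgr_dnbhsP => u [u0 ucvg].
(* Beyond rank N the increments keep s + u n positive; convergence only depends
   on that tail of the sequence. *)
have [N _ u_small] : \forall n \near \oo, `|u n| < s by exact: cvgr0_norm_lt ucvg _ _.
rewrite -(cvg_shiftn N).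
have uN_cvg : (u (n + N)%N) @[n --> \oo] --> 0 by rewrite (cvg_shiftn N u).
apply: cvg_trans (@laplace_slope_cvg s (fun n => u (n + N)%N) s0 _ _ uN_cvg).
- by apply: near_eq_cvg; apply: nearW => n; rewrite /= scaler1 (addrC s).
- move=> n; have := u_small (n + N)%N (leq_addl _ _).
  by rewrite /= ltr_norml => /andP[/ltW + _]; rewrite addrC -lerBlDr sub0r.
- by move=> n; exact: u0.
Qed.
End laplace_transform.
End laplace.

(** * Expected counts *)

Section counting.
Context d (T : measurableType d) (R : realType) (P : probability T R).

Lemma expectation_card (I : finType) (B : T -> pred I) :
  (forall k, measurable [set w | B w k]) ->
  ('E_P[fun w => #|[pred k | B w k]|%:R] = \sum_k P [set w | B w k])%E.
Proof.
move=> mB; rewrite unlock.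
transitivity (\int[P]_w \sum_k (\1_[set w | B w k] w : R)%:E)%E.
  apply: eq_integral => w _; rewrite sumEFin; congr EFin.
  rewrite -sum1_card natr_sum big_mkcond; apply: eq_bigr => k _.
  rewrite indicE unfold_in /=; case: ifPn => [Bwk|/negP Bwk].
    by rewrite mem_set.
  by rewrite memNset.
rewrite ge0_integral_sum//; last first.
  by move=> k; apply/measurable_EFinP; exact: measurable_indic.
by apply: eq_bigr => k _; rewrite integral_indic// setIT.
Qed.

End counting.

(** Column [j] contains [j] pairs, and these sum to a binomial coefficient. *)
Lemma card_ltn_pairs n :
  #|[pred ij : 'I_n * 'I_n | (ij.1 < ij.2)%N]| = 'C(n, 2).
Proof.
rewrite -sum1_card -(pair_big_dep xpredT (fun i j : 'I_n => (i < j)%N) (fun _ _ => 1%N))/=.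
rewrite (exchange_big_dep xpredT)//= -bin2_sum big_mkord.
apply: eq_bigr => j _.
by rewrite (big_ord_narrow (ltnW (ltn_ord j))) sum1_card card_ord.
Qed.

Lemma natr_bin2 (R : numFieldType) n : 'C(n, 2)%:R = n%:R * (n%:R - 1) / 2 :> R.
Proof.
case: n => [|n]; first by rewrite bin0n !mul0r.
apply: (@mulIf _ 2%:R); first by rewrite pnatr_eq0.
rewrite divfK ?pnatr_eq0// -natrM -[X in (_ * X)%N]/(2`!) bin_ffact.
by rewrite ffactnS ffactn1/= natrM; congr (_ * _); rewrite -natr1 addrK.
Qed.

(** * Distance densities *)

Lemma distance_law_density_total d (R : realType)
    (M : measurableMetricType d R) (U : probability M R) (g : R -> R) :
  has_density (distance_law U) g ->
  (\int[lebesgue_measure]_(t in `[0%R : R, +oo[%classic) (g t)%:E = 1)%E.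
Proof.
move=> [_ _ /(_ setT measurableT)]; rewrite setTI => <-.
exact: (probability_setT (U \x U)%E).
Qed.

Lemma distance_density_integrable d (R : realType)
    (M : measurableMetricType d R) (U : probability M R) (g : R -> R) :
  has_density (distance_law U) g ->
  lebesgue_measure.-integrable `[0%R : R, +oo[%classic (EFin \o g).
Proof.
move=> g_dens; have [mg g_ge0 _] := g_dens.
apply/integrableP; split; first exact/measurable_EFinP.
rewrite (_ : integral _ _ _ = 1%E) ?ltry//.
rewrite -(distance_law_density_total g_dens).
apply: eq_integral => t; rewrite inE/= in_itv/= andbT => t0.
by rewrite ger0_norm ?g_ge0.
Qed.

Lemma laplace_distance_density_gt0 d (R : realType)
    (M : measurableMetricType d R) (U : probability M R) (g : R -> R) (s : R) :
  has_density (distance_law U) g -> 0 <= s -> 0 < laplace g s.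
Proof.
move=> g_dens s0; have [_ g_ge0 _] := g_dens.
apply: laplace_gt0 => //; first exact: distance_density_integrable g_dens.
by rewrite (distance_law_density_total g_dens) onee_eq0.
Qed.

(** * The length of an edge *)

Lemma mnormalizeE d (T : measurableType d) (R : realType)
    (mu : {measure set T -> \bar R}) (P : probability T R) (A : set T) (r : R) :
  0 < r -> mu setT = r%:E -> mnormalize mu P A = (mu A * r^-1%:E)%E.
Proof. by move=> r0 muT; rewrite /mnormalize muT eqe gt_eqF. Qed.

Section conditional_length.
Context d d' (T : measurableType d) (R : realType)
  (M : measurableMetricType d' R) (P : probability T R) (U : probability M R)
  (g : R -> R) (n : nat) (q s : R) (W : waxman_graph P U n q s).
Hypothesis mdist_meas : measurable_fun setT (fun xy : M * M => mdist xy.1 xy.2).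
Hypothesis g_dens : has_density (distance_law U) g.
Hypotheses (q_gt0 : 0 < q) (s_ge0 : 0 <= s).
Local Notation leb := (@lebesgue_measure R).
Local Notation Rplus := (`[0%R : R, +oo[%classic).

Let g_ge0 t : 0 <= t -> 0 <= g t. Proof. by case: g_dens => _ + _; exact. Qed.

Let mR : measurable Rplus. Proof. exact: measurable_itv. Qed.

Let mg : measurable_fun Rplus g. Proof. by case: g_dens. Qed.

Let integrable_g : leb.-integrable Rplus (EFin \o g).
Proof. exact: distance_density_integrable g_dens. Qed.

Let L_gt0 : 0 < laplace g s.
Proof. exact: laplace_distance_density_gt0 g_dens s_ge0. Qed.

Lemma prob_edge (i j : 'I_n) : i != j ->
  P (edge W i j) = (q * laplace g s)%:E.
Proof.
move=> ij; have := prob_edge_len W mdist_meas q_gt0 g_dens ij measurableT.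
rewrite preimage_setT setIT setTI => ->.
under eq_integral do rewrite /waxman_prob -mulrA EFinM.
rewrite ge0_integralZl//.
- by rewrite EFinM EFin_laplace.
- exact: measurable_int (integrable_damped s_ge0 integrable_g).
- by move=> t; rewrite /= in_itv/= andbT => t0; rewrite lee_fin mulr_ge0 ?expR_ge0 ?g_ge0.
- by rewrite lee_fin ltW.
Qed.

Lemma edge_condE (i j : 'I_n) (A : set T) : i != j ->
  edge_cond W i j A = (P (edge W i j `&` A) * (q * laplace g s)^-1%:E)%E.
Proof.
move=> ij; have evidence : mrestr P (adj_measurable W i j) setT = (q * laplace g s)%:E.
  by transitivity (P (setT `&` edge W i j)) => //; rewrite setTI prob_edge.
by rewrite [LHS](mnormalizeE P A _ evidence) ?mulr_gt0// [in RHS]setIC.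
Qed.

(** Dividing the joint law by the edge probability [q * laplace g s]; the factor
[q] appears in both and cancels. *)
Lemma len_has_density (i j : 'I_n) : i != j ->
  has_density (fun A => edge_cond W i j (len W i j @^-1` A))
    (edge_length_density g s).
Proof.
move=> ij; split.
- apply: measurable_funM => //; apply: measurable_funM => //.
  by apply: measurableT_comp => //; exact: measurable_funM.
- move=> t t0; rewrite /edge_length_density divr_ge0 ?mulr_ge0 ?expR_ge0 ?g_ge0//.
  exact: ltW.
- move=> A mA; rewrite edge_condE// (prob_edge_len W mdist_meas q_gt0 g_dens)//.
  have mAR : measurable (A `&` Rplus) by exact: measurableI.
  rewrite -ge0_integralZr//.
  + apply: eq_integral => t _; rewrite -EFinM; congr EFin.
    rewrite /waxman_prob /edge_length_density; field.
    by rewrite !gt_eqF.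
  + apply/measurable_EFinP; apply: measurable_funM; last first.
      by apply: measurable_funS mg => //; exact: subIsetr.
    exact: measurable_waxman_prob.
  + move=> t [_]; rewrite /= in_itv/= andbT => t0.
    by rewrite lee_fin mulr_ge0 ?g_ge0// mulr_ge0 ?expR_ge0// ltW.
  + by rewrite lee_fin invr_ge0 ltW// mulr_gt0.
Qed.

Hypothesis tg_int : leb.-integrable Rplus (EFin \o (fun t => t * g t)).

Lemma mean_edge_length (i j : 'I_n) : i != j ->
  ('E_(edge_cond W i j)[len W i j])%E =
  ((laplace g s)^-1 *
    \int[leb]_(t in Rplus) (t * g t * expR (- s * t)))%:E.
Proof.
move=> ij; rewrite unlock.
(* The transfer to the density needs an integrand that is nonnegative on the
   whole line, hence the absolute value. *)
transitivity (\int[edge_cond W i j]_(w in len W i j @^-1` setT)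
    `|len W i j w|%:E)%E.
  by rewrite preimage_setT; apply: eq_integral => w _; rewrite ger0_norm ?mdist_ge0.
rewrite (@integral_has_density _ _ _ (edge_cond W i j) (len W i j)
  (edge_length_density g s) (fun x => `|x|%:E)) //.
- have moment_int :
      leb.-integrable Rplus (EFin \o (fun t => t * g t * expR (- s * t))).
    rewrite (_ : (fun t => _) = (fun t => expR (- s * t) * (t * g t))).
      exact: integrable_damped.
    by apply/funext => t; rewrite mulrC.
  rewrite setTI EFinM fineK; last exact: integrable_fin_num.
  rewrite -ge0_integralZl_EFin//.
  + apply: eq_integral => t; rewrite inE/= in_itv/= andbT => t0.
    rewrite -!EFinM; congr EFin; rewrite ger0_norm// /edge_length_density.
    by field; rewrite gt_eqF.
  + move=> t; rewrite /= in_itv/= andbT => t0.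
    by rewrite lee_fin mulr_ge0 ?expR_ge0// mulr_ge0 ?g_ge0.
  + exact: measurable_int moment_int.
  + by rewrite invr_ge0 ltW.
- exact: measurable_len.
- exact: len_has_density.
- by apply/measurable_EFinP; exact: normr_measurable.
Qed.
End conditional_length.

(** * The theorem *)

Unset Implicit Arguments.

Theorem mainTheorem1 (d d' : measure_display) (T : measurableType d)
  (R : realType) (M : measurableMetricType d' R)
  (nu : {measure set M -> \bar R}) (D : set M) (U : probability M R)
  (g : R -> R) (P : probability T R) (n : nat) (q s : R)
  (mdist_meas : measurable_fun setT (fun xy : M * M => mdist xy.1 xy.2))
  (U_unif : uniform_on nu D U)
  (g_dens : has_density (distance_law U) g)
  (g_mean : (\int[lebesgue_measure]_(t in `[0%R, +oo[) (t * g t)%:E < +oo)%E)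
  (n_ge2 : (2 <= n)%N) (q_gt0 : 0 < q) (q_le1 : q <= 1) (s_ge0 : 0 <= s)
  (W : waxman_graph P U n q s) :
  [/\ (* (a) *)
      forall i j : 'I_n, i <> j -> P (edge W i j) = (q * laplace g s)%:E,
      (* (b) *)
      forall i : 'I_n, ('E_P[fun w => (degree W i w)%:R])%E =
        ((n%:R - 1) * q * laplace g s)%:E,
      (* (c) *)
      ('E_P[fun w => (num_edges W w)%:R])%E =
        (n%:R * (n%:R - 1) * q * laplace g s / 2)%:E,
      (* (d) *)
      0 < laplace g s /\
      forall i j : 'I_n, i <> j ->
        has_density (fun A => edge_cond W i j (len W i j @^-1` A))
          (edge_length_density g s) &
      (* (e) *)
      forall i j : 'I_n, i <> j ->
        ('E_(edge_cond W i j)[len W i j])%E =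
          ((laplace g s)^-1 *
            \int[lebesgue_measure]_(t in `[0, +oo[)
              (t * g t * expR (- s * t)))%:E /\
        exists G' : R, is_laplace_deriv g s G' /\
          ('E_(edge_cond W i j)[len W i j])%E = (- (G' / laplace g s))%:E].
Proof.
have [mg g_ge0 _] := g_dens.
have tg_int : lebesgue_measure.-integrable `[0%R : R, +oo[%classic
    (EFin \o (fun t => t * g t)).
  apply/integrableP; split.
    by apply/measurable_EFinP; apply: measurable_funM.
  apply: le_lt_trans g_mean; rewrite le_eqVlt; apply/orP; left; apply/eqP.
  apply: eq_integral => t; rewrite inE/= in_itv/= andbT => t0.
  by rewrite ger0_norm// mulr_ge0 ?g_ge0.
have edgeE i j : i != j -> P (edge W i j) = (q * laplace g s)%:E.
  exact: prob_edge.
have neqP (i j : 'I_n) : i <> j -> i != j by move/eqP.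
split.
- by move=> i j /neqP; exact: edgeE.
- move=> i; rewrite (expectation_card P (B := fun w j => adj W w i j)); last first.
    by move=> j; exact: adj_measurable.
  (* The node i itself contributes 0 by irreflexivity. *)
  rewrite (bigD1 i)//= [X in (X + _)%E](_ : _ = 0%E); last first.
    rewrite (_ : [set w | _] = set0) ?measure0//.
    by rewrite -subset0 => w; rewrite /= adj_irr.
  rewrite add0e (eq_bigr (fun=> (q * laplace g s)%:E)); last first.
    by move=> j ji; apply: edgeE; rewrite eq_sym.
  rewrite sumEFin sumr_const cardC1 card_ord -[_ *+ n.-1]mulr_natl mulrA.
  by rewrite -[in RHS](ltn_predK n_ge2) -natr1 addrK.
- rewrite (expectation_card P
    (B := fun w (ij : 'I_n * 'I_n) => (ij.1 < ij.2)%N && adj W w ij.1 ij.2)); last first.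
    move=> ij; case: (ij.1 < ij.2)%N => /=; first exact: adj_measurable.
    by rewrite (_ : [set w | _] = set0)// -subset0.
  rewrite (bigID (fun ij : 'I_n * 'I_n => (ij.1 < ij.2)%N))/= [X in (_ + X)%E]big1 ?adde0.
    rewrite (eq_bigr (fun=> (q * laplace g s)%:E)); last first.
      move=> ij lt_ij; rewrite lt_ij/=; apply: edgeE.
      by rewrite -val_eqE/= ltn_eqF.
    rewrite sumEFin sumr_const card_ltn_pairs -[_ *+ 'C(n, 2)]mulr_natl natr_bin2; congr EFin.
    by field.
  move=> ij /negPf ->; rewrite (_ : [set w | _] = set0) ?measure0//.
  by rewrite -subset0.
- split.
    exact: laplace_distance_density_gt0 g_dens s_ge0.
  by move=> i j /neqP ij; exact: len_has_density.
- move=> i j /neqP ij; have meanE := mean_edge_length W mdist_meas g_dens q_gt0 s_ge0 tg_int ij.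
  split; first exact: meanE.
  exists (- (\int[lebesgue_measure]_(t in `[0, +oo[) (t * g t * expR (- s * t)))).
  split.
    apply: is_laplace_deriv_moment => //.
    exact: distance_density_integrable g_dens.
  rewrite meanE; congr EFin; ring.
Qed.
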